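(* Consider the problem Edge Triangle $s$-Club with $\ell=1$ (and $s$ a fixed integer), parameterized by $k$. It admits a Turing kernel with $k^2$ vertices if $s$ is even, and a Turing kernel with $k^3$ vertices if $s$ is odd and $s\ge 3$.
   Context: A vertex set $S$ of a graph $G$ fulfills the edge-$\ell$-triangle property (for given $s$) if $G[S]$ contains a spanning subgraph $G'=(S,E')$ such that every edge of $E'$ is contained in at least $\ell$ triangles of $G'$ and the diameter of $G'$ is at most $s$. Edge Triangle $s$-Club: given an undirected graph $G$ and integers $k,\ell\ge1$, decide whether $G$ contains a vertex set $S$ with $|S|\ge k$ fulfilling the edge-$\ell$-triangle property. A Turing kernel with $f(k)$ vertices is a polynomial-time algorithm that decides every instance while having access to an oracle which, in a single step, answers whether a given instance of the same problem whose graph has at most $f(k)$ vertices is a yes-instance. *)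

(* Defs.v *)
From mathcomp Require Import all_boot.

Set Implicit Arguments.
Unset Strict Implicit.
Unset Printing Implicit Defensive.

Definition simple_graph (T : finType) (e : rel T) : Prop :=
  symmetric e /\ irreflexive e.

Definition triangles (T : finType) (e : rel T) : {set {set T}} :=
  [set A : {set T} | (#|A| == 3) &&
     [forall x in A, forall y in A, (x != y) ==> e x y]].

Definition walk (T : finType) (e : rel T) (x y : T) (d : nat) : Prop :=
  exists p : seq T, [/\ path e x p, last x p = y & size p = d].

(* [distance e x y d]: the distance of x and y is the finite number d. It holds
   for no d when x and y lie in different components. *)
Definition distance (T : finType) (e : rel T) (x y : T) (d : nat) : Prop :=
  walk e x y d /\ (forall d' : nat, walk e x y d' -> d <= d').

(* The graph with vertex set S and edge relation e has diameter at most s. *)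
Definition diameter_at_most (T : finType) (S : {set T}) (e : rel T) (s : nat) :
    Prop :=
  forall x y : T, x \in S -> y \in S -> exists2 d, distance e x y d & d <= s.

(* (S, e') is a spanning subgraph of the induced subgraph G[S], G = (T, e). *)
Definition spanning_subgraph (T : finType) (e : rel T) (S : {set T})
    (e' : rel T) : Prop :=
  symmetric e' /\ (forall x y : T, e' x y -> [/\ x \in S, y \in S & e x y]).

Definition edge_triangle_property (s l : nat) (T : finType) (e : rel T)
    (S : {set T}) : Prop :=
  exists e' : rel T,
    [/\ spanning_subgraph e S e',
        forall x y : T, e' x y ->
          l <= #|[set A in triangles e' | (x \in A) && (y \in A)]|
      & diameter_at_most S e' s].

(* The instances are the pairs (G, k) with G a simple graph on the vertex set
   {0, ..., n-1} and k >= 1. The values on other arguments are irrelevant. *)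
Definition graph_problem := forall n : nat, rel 'I_n -> nat -> Prop.

Definition is_instance (n : nat) (e : rel 'I_n) (k : nat) : Prop :=
  simple_graph e /\ 0 < k.

Definition edge_triangle_s_club (s l : nat) : graph_problem :=
  fun n e k =>
    exists S : {set 'I_n}, k <= #|S| /\ edge_triangle_property s l e S.

(* Adjacency matrix plus the binary expansion of k. *)
Definition instance_size (n k : nat) : nat := n ^ 2 + (trunc_log 2 k).+1.

(* Structured programs of a unit-cost random access machine with addition and
   truncated subtraction. There is deliberately no multiplication: in t steps
   the bit length of the stored numbers grows by O(t) only, so that time is
   polynomially related to Turing machine time. The memory is divided into
   arrays of natural numbers; array names are literals of the program, hence a
   program accesses a bounded number of arrays. A scalar variable is cell 0 of
   an array. *)

Inductive expr : Type :=
| Const of nat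
| Cell of nat & expr          (* [Cell a i] reads a[i] *)
| Plus of expr & expr
| Minus of expr & expr.

Inductive cmd : Type :=
| Skip
| Store of nat & expr & expr  (* [Store a i v] is a[i] := v *)
| Seq of cmd & cmd
| If of expr & cmd & cmd
| While of expr & cmd
| Query of nat & expr & expr & nat.
    (* [Query r n k a]: r[0] := the oracle's answer to the instance with
       parameter k whose n x n adjacency matrix is stored in array a *)

Definition state := nat -> nat -> nat.

Definition update (m : state) (a i v : nat) : state :=
  fun b j => if (b == a) && (j == i) then v else m b j.

Fixpoint eval (m : state) (x : expr) : nat :=
  match x with
  | Const v => v
  | Cell a i => m a (eval m i)
  | Plus x1 x2 => eval m x1 + eval m x2
  | Minus x1 x2 => eval m x1 - eval m x2
  end.

(* Row-major adjacency matrix; nonzero entries are edges. *)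
Definition decode (n : nat) (M : nat -> nat) : rel 'I_n :=
  fun x y => M (x * n + y) != 0.

Definition encode (n : nat) (e : rel 'I_n) : nat -> nat :=
  fun i => [exists x : 'I_n, exists y : 'I_n, (i == x * n + y) && e x y].

(* [exec Q N c m t m']: started in m and given the oracle for those instances
   of Q that have at most N vertices, c halts in m' after t steps. A query which
   is not such an instance gets stuck. On top of its single step, a query is
   charged the size of its matrix: the oracle reads it from memory, where,
   unlike on the query tape of a Turing machine, it need not have been written
   entry by entry. *)
Inductive exec (Q : graph_problem) (N : nat) :
    cmd -> state -> nat -> state -> Prop :=
| ExecSkip m : exec Q N Skip m 1 m
| ExecStore a i v m :
    exec Q N (Store a i v) m 1 (update m a (eval m i) (eval m v))
| ExecSeq c1 c2 m m1 m2 t1 t2 :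
    exec Q N c1 m t1 m1 -> exec Q N c2 m1 t2 m2 ->
    exec Q N (Seq c1 c2) m (t1 + t2) m2
| ExecIfTrue x c1 c2 m m1 t :
    eval m x != 0 -> exec Q N c1 m t m1 -> exec Q N (If x c1 c2) m t.+1 m1
| ExecIfFalse x c1 c2 m m1 t :
    eval m x = 0 -> exec Q N c2 m t m1 -> exec Q N (If x c1 c2) m t.+1 m1
| ExecWhileTrue x c m m1 m2 t1 t2 :
    eval m x != 0 -> exec Q N c m t1 m1 -> exec Q N (While x c) m1 t2 m2 ->
    exec Q N (While x c) m (t1 + t2).+1 m2
| ExecWhileFalse x c m : eval m x = 0 -> exec Q N (While x c) m 1 m
| ExecQuery r xn xk a m (b : bool) (n := eval m xn) (k := eval m xk)
    (e := @decode n (m a)) :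
    is_instance e k -> n <= N -> reflect (Q n e k) b ->
    exec Q N (Query r xn xk a) m (n ^ 2).+1 (update m r 0 b).

(* Input: n in array 0, k in array 1, the adjacency matrix in array 2. *)
Definition input_state (n : nat) (e : rel 'I_n) (k : nat) : state :=
  fun a i =>
    match a, i with
    | 0, 0 => n
    | 1, 0 => k
    | 2, _ => encode e i
    | _, _ => 0
    end.

Definition accepting (m : state) : Prop := m 0 0 != 0.

(* Q, parameterized by k, has a Turing kernel with f k vertices. The program
   and the polynomial bound c * N ^ c are uniform in the instance. *)
Definition turing_kernel (Q : graph_problem) (f : nat -> nat) : Prop :=
  exists (prog : cmd) (c : nat),
    forall (n : nat) (e : rel 'I_n) (k : nat), is_instance e k ->
      exists (t : nat) (m : state),
        [/\ exec Q (f k) prog (input_state e k) t m,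
            t <= c * instance_size n k ^ c
          & accepting m <-> Q n e k].

(* Main.v *)
Require Import Defs.
From mathcomp Require Import all_boot zify.
From Stdlib Require Import Classical.

(* Only edges lying in triangles matter; distances below are taken in the graph
   of these edges. Put h = floor(s/2). The ball of radius h around any vertex
   fulfills the edge-1-triangle property, so if some such ball has at least k
   vertices, the answer is yes. Otherwise all balls of radius h have fewer than k
   vertices, and a ball of radius s <= c h has at most k^c vertices, where c = 2
   for s even and c = 3 for s odd, s >= 3. A solution lies in the ball of radius s
   around each of its vertices, so it suffices to query the oracle on the
   subgraphs induced by these balls. *)

Set Implicit Arguments.
Unset Strict Implicit.
Unset Printing Implicit Defensive.

(** * Balls and triangles *)

(** The disjunct [w == y] lets a walk pause, so [j] bounds the number of edges from above. This is
    the [j]-th Boolean power of the reflexive closure of [r], the form in which the program computes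
    it. *)
Fixpoint steps (T : finType) (r : rel T) (j : nat) (x y : T) : bool :=
  if j is i.+1 then [exists w, steps r i x w && ((w == y) || r w y)] else x == y.

Lemma stepsSP (T : finType) (r : rel T) (j : nat) (x y : T) :
  reflect (exists2 w, steps r j x w & (w == y) || r w y) (steps r j.+1 x y).
Proof. exact: exists_inP. Qed.

Lemma stepsW (T : finType) (r : rel T) (i j : nat) (x y : T) :
  i <= j -> steps r i x y -> steps r j x y.
Proof.
move=> /subnK <-; elim: (j - i) => // d IHd /IHd xy.
by rewrite addSn; apply/stepsSP; exists y; rewrite ?eqxx.
Qed.

Lemma steps_add (T : finType) (r : rel T) (i j : nat) (x y : T) :
  reflect (exists2 w, steps r i x w & steps r j w y) (steps r (i + j) x y).
Proof.
apply: (iffP idP) => [|[w xw]].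
  elim: j y => [|j IHj] y; first by rewrite addn0; exists y => /=.
  rewrite addnS => /stepsSP[z /IHj[w xw wz] zy].
  by exists w => //; apply/stepsSP; exists z.
elim: j y => [|j IHj] y; first by rewrite addn0 => /eqP <-.
by move=> /stepsSP[z /IHj xz zy]; rewrite addnS; apply/stepsSP; exists z.
Qed.

Lemma steps_sym (T : finType) (r : rel T) (j : nat) :
  symmetric r -> symmetric (steps r j).
Proof.
move=> rsym; suff imp x y : steps r j x y -> steps r j y x.
  by move=> x y; apply/idP/idP; apply: imp.
elim: j x y => [|j IHj] x y; first by rewrite /= eq_sym.
move=> /stepsSP[w /IHj wx wy]; rewrite -add1n; apply/steps_add; exists w => //.
by apply/stepsSP; exists y => /=; rewrite ?eqxx // rsym eq_sym.
Qed.

Lemma steps_hom (T U : finType) (f : T -> U) (r : rel T) (q : rel U) (j : nat)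
    (x y : T) :
  (forall u v, r u v -> q (f u) (f v)) ->
  steps r j x y -> steps q j (f x) (f y).
Proof.
move=> rq; elim: j y => [|j IHj] y; first by move=> /eqP -> /=.
move=> /stepsSP[w /IHj xw wy]; apply/stepsSP; exists (f w) => //.
by case/orP: wy => [/eqP->|/rq->]; rewrite ?eqxx ?orbT.
Qed.

Lemma stepsP (T : finType) (r : rel T) (j : nat) (x y : T) :
  reflect (exists2 d, walk r x y d & d <= j) (steps r j x y).
Proof.
apply: (iffP idP) => [|[d [p [rp <- <-]] /stepsW]].
  elim: j y => [|j IHj] y; first by move=> /eqP <-; exists 0 => //; exists [::].
  move=> /stepsSP[w /IHj[d [p [rp pw dE]] lt_d] /orP[/eqP <-|wy]].
    by exists d; [exists p | apply: leqW].
  exists d.+1 => //; exists (rcons p y).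
  by rewrite rcons_path rp pw last_rcons size_rcons dE.
apply; elim/last_ind: p rp => [|p z IHp] //; first by move=> _ /=.
rewrite rcons_path last_rcons size_rcons => /andP[/IHp xw wz].
by apply/stepsSP; exists (last x p); rewrite ?wz ?orbT.
Qed.

(** The balls of radius [h] around the vertices of the ball of radius [c * h] cover the ball of
    radius [c.+1 * h], so each increase of [c] costs a factor of at most [k]. *)
Lemma card_steps_mul (T : finType) (r : rel T) (h k c : nat) (v : T) :
  (forall u, #|[set y | steps r h u y]| <= k) ->
  #|[set y | steps r (c * h) v y]| <= k ^ c.
Proof.
move=> le_k; elim: c => [|c IHc].
  rewrite mul0n expn0 -(cards1 v); apply: subset_leq_card.
  by apply/subsetP => y; rewrite !inE eq_sym.
rewrite mulSnr expnSr; apply: leq_trans (leq_mul IHc (leqnn k)).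
set B := [set y | steps r (c * h) v y].
apply: (@leq_trans (\sum_(u in B) #|[set y | steps r h u y]|)); last first.
  by rewrite -sum_nat_const; apply: leq_sum => u _.
apply: (@leq_trans #|\bigcup_(u in B) [set y | steps r h u y]|); last first.
  apply: (big_ind2 (fun (A : {set T}) a => #|A| <= a)) => [|A a A' a' Aa A'a'|//].
    by rewrite cards0.
  exact: leq_trans (leq_card_setU A A') (leq_add Aa A'a').
apply: subset_leq_card; apply/subsetP => y; rewrite inE => /steps_add[w vw wy].
by apply/bigcupP; exists w; rewrite inE.
Qed.

(** * Diameter and triangle conditions in terms of [steps] and third vertices *)

Lemma diameter_at_mostP (T : finType) (S : {set T}) (r : rel T) (s : nat) :
  diameter_at_most S r s <-> {in S &, forall x y, steps r s x y}.
Proof.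
split=> diam x y xS yS.
  by have [d [wd _] le_d] := diam x y xS yS; apply/stepsP; exists d.
(* The least [d] admitting [steps r d x y] is the distance: it yields a walk of length at most [d],
   and no walk is shorter than [d]. *)
have ex : exists d, steps r d x y by exists s; apply: diam.
case: (ex_minnP ex) => d /stepsP[d' w le_d] min_d.
have min_w i : walk r x y i -> d <= i.
  by move=> wi; apply: min_d; apply/stepsP; exists i.
have dE : d' = d by apply/eqP; rewrite eqn_leq le_d min_w.
by exists d; [split; rewrite -?dE // dE | apply: min_d; apply: diam].
Qed.

(** A triangle without [x] and [y] still has one vertex, the desired [w]. Conversely, irreflexivity
    makes [x], [y], [w] distinct, so they form a set of size three. *)
Lemma edge_in_triangleP (T : finType) (r : rel T) (x y : T) :
  symmetric r -> irreflexive r -> r x y ->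
  0 < #|[set A in triangles r | (x \in A) && (y \in A)]| <->
  exists2 w, r x w & r w y.
Proof.
move=> rsym rirr rxy; have neq u v : r u v -> u != v.
  by apply: contraTneq => ->; rewrite rirr.
split=> [/card_gt0P[A]|[w xw wy]].
  rewrite !inE => /andP[/andP[/eqP A3 /forall_inP adj] /andP[xA yA]].
  have /card_gt0P[w] : 0 < #|A :\ x :\ y|.
    have := cardsD1 x A; have := cardsD1 y (A :\ x).
    by rewrite !inE xA yA eq_sym (neq _ _ rxy) A3; lia.
  rewrite !inE => /and3P[wy wx wA]; exists w.
    by have /forall_inP/(_ w wA)/implyP := adj x xA; apply; rewrite eq_sym.
  by have /forall_inP/(_ y yA)/implyP := adj w wA; apply.
apply/card_gt0P; exists [set x; y; w].
rewrite !inE !eqxx !orbT /= andbT; apply/andP; split.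
  by rewrite setUC cardsU1 cards2 !inE negb_or (eq_sym w) !neq // rsym.
apply/forall_inP => u uA; apply/forall_inP => v vA; apply/implyP => uv.
move: uA vA uv; rewrite !inE -!orbA.
by do 2![case/or3P=> /eqP->]; rewrite ?eqxx // ?rxy ?xw ?wy // rsym ?rxy ?xw ?wy.
Qed.

Lemma edge_triangle_property1P (T : finType) (e : rel T) (S : {set T}) (s : nat) :
  irreflexive e ->
  edge_triangle_property s 1 e S <->
  exists r : rel T,
    [/\ spanning_subgraph e S r,
        forall x y, r x y -> exists2 w, r x w & r w y
      & {in S &, forall x y, steps r s x y}].
Proof.
move=> eirr; split=> -[r [rS tri /diameter_at_mostP diam]]; exists r; split=> //;
  move=> x y rxy; have [rsym sub] := rS;
  have rirr : irreflexive r by (move=> z; apply/negP => /sub[_ _]; rewrite eirr).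
- by apply/edge_in_triangleP => //; apply: tri.
- by apply/edge_in_triangleP => //; apply: tri.
Qed.

Definition triangle_edge (T : finType) (e : rel T) : rel T :=
  fun x y => [exists w, [&& e x w, e w y & e x y]].

Lemma triangle_edge_sym (T : finType) (e : rel T) :
  symmetric e -> symmetric (triangle_edge e).
Proof.
move=> esym x y; rewrite /triangle_edge (esym y x); apply: eq_existsb => w.
by rewrite (esym y w) (esym w x) andbCA.
Qed.

(* A triangle on the last edge of a shortest path of length j from v has all of
   its vertices at distance at most j, so the shortest paths survive when
   only the triangles inside the ball are kept. *)
Lemma ball_edge_triangle (T : finType) (e : rel T) (h s : nat) (v : T) :
  simple_graph e -> h.*2 <= s ->
  edge_triangle_property s 1 e [set y | steps (triangle_edge e) h v y].
Proof.
move=> [esym eirr] le_s; set S := [set y | _].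
(* The restriction to the ball comes first: the triangles on an edge of [e] inside the ball may
   leave it, whereas those of [q] stay inside. *)
pose q x y := (x \in S) && (y \in S) && e x y.
have qsym : symmetric q by move=> x y; rewrite /q esym (andbC (y \in S)).
apply/edge_triangle_property1P => //; exists (triangle_edge q).
have tsym := triangle_edge_sym qsym.
split.
- by split=> // x y /existsP[w /and3P[_ _ /andP[/andP[]]]].
- move=> x y /existsP[w /and3P[xw wy xy]]; exists w; apply/existsP.
    by exists y; rewrite xy xw qsym wy.
  by exists x; rewrite xy wy qsym xw.
have vS y j : j <= h -> steps (triangle_edge e) j v y ->
    steps (triangle_edge q) j v y.
  elim: j y => [|j IHj] y lt_j //.
  move=> /stepsSP[w vw wy]; apply/stepsSP; exists w; first exact: IHj (ltnW lt_j) vw.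
  case/orP: wy => [->//|wy]; apply/orP; right.
  have inS u : (w == u) || triangle_edge e w u -> u \in S.
    by move=> wu; rewrite inE; apply: stepsW lt_j _; apply/stepsSP; exists w.
  case/existsP: (wy) => u /and3P[wu uy ewy]; apply/existsP; exists u.
  rewrite /q wu uy ewy !inS ?eqxx ?wy ?orbT //.
  (* The edge from [w] to [u] lies in the same triangle, with [y] as third vertex, so [u] is one
     step from [w]. *)
  by apply/orP; right; apply/existsP; exists y; rewrite wu ewy esym uy.
move=> x y; rewrite 2!inE => /vS vx /vS vy; apply: stepsW le_s _.
rewrite -addnn; apply/steps_add; exists v; last exact: vy.
by rewrite steps_sym // vx.
Qed.

(** An edge of the witnessing subgraph lies in a triangle of that subgraph, hence of [e]; so its
    walks run along triangle edges of [e]. *)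
Lemma edge_triangle_sub_ball (T : finType) (e : rel T) (s : nat) (S : {set T})
    (v : T) :
  irreflexive e -> edge_triangle_property s 1 e S -> v \in S ->
  S \subset [set y | steps (triangle_edge e) s v y].
Proof.
move=> eirr /edge_triangle_property1P-/(_ eirr)[r [[_ sub] tri diam]] vS.
apply/subsetP => y yS; rewrite inE; have := diam v y vS yS.
apply: (@steps_hom _ _ id) => {}x {yS}y rxy; have [w xw wy] := tri x y rxy.
by apply/existsP; exists w; have [_ _ ->] := sub _ _ rxy;
  have [_ _ ->] := sub _ _ xw; have [_ _ ->] := sub _ _ wy.
Qed.

(** * Transport of the property along induced embeddings *)

Lemma edge_triangle_imset (T U : finType) (f : T -> U) (e : rel T) (g : rel U)
    (s : nat) (S : {set T}) :
  injective f -> (forall x y, e x y = g (f x) (f y)) -> irreflexive g ->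
  edge_triangle_property s 1 e S -> edge_triangle_property s 1 g (f @: S).
Proof.
move=> finj eg girr /edge_triangle_property1P[|r [[rsym sub] tri diam]].
  by move=> x; rewrite eg girr.
pose q u v := [exists x, exists y, [&& u == f x, v == f y & r x y]].
have qP u v : reflect (exists x y, [/\ u = f x, v = f y & r x y]) (q u v).
  apply: (iffP existsP) => [[x /existsP[y /and3P[/eqP-> /eqP-> rxy]]]|].
    by exists x, y.
  by move=> [x [y [-> -> rxy]]]; exists x; apply/existsP; exists y; rewrite !eqxx.
apply/edge_triangle_property1P => //; exists q; split.
- split=> [u v|u v /qP[x [y [-> -> rxy]]]].
    by apply/qP/qP => -[x [y [-> -> rxy]]]; exists y, x; rewrite rsym.
  by have [xS yS exy] := sub _ _ rxy; rewrite !imset_f // -eg.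
- move=> _ _ /qP[x [y [-> -> /tri[w xw wy]]]].
  by exists (f w); apply/qP; [exists x, w | exists w, y].
move=> _ _ /imsetP[x xS ->] /imsetP[y yS ->].
by apply: steps_hom (diam x y xS yS) => a b rab; apply/qP; exists a, b.
Qed.

(** The witness [r] is pulled back along [f]. Third vertices and inner vertices of walks are
    endpoints of edges of [r], so they lie in [S] and have preimages. *)
Lemma edge_triangle_preimset (T U : finType) (f : T -> U) (e : rel T)
    (g : rel U) (s : nat) (S : {set U}) :
  injective f -> (forall x y, e x y = g (f x) (f y)) -> irreflexive g ->
  S \subset f @: setT ->
  edge_triangle_property s 1 g S -> edge_triangle_property s 1 e (f @^-1: S).
Proof.
move=> finj eg girr Sf /edge_triangle_property1P[//|r [[rsym sub] tri diam]].
have inf u : u \in S -> exists x, u = f x.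
  by move=> /(subsetP Sf)/imsetP[x _ ->]; exists x.
apply/edge_triangle_property1P; first by move=> x; rewrite eg girr.
exists (fun x y => r (f x) (f y)); split.
- by split=> // x y /sub[]; rewrite !inE eg.
- move=> x y /tri[w xw wy]; have [_ /inf[z wE] _] := sub _ _ xw.
  by exists z; rewrite -wE.
move=> x y; rewrite !inE => xS yS; have := diam _ _ xS yS.
suff lift j u : steps r j (f x) u ->
    exists2 z, u = f z & steps (fun x y => r (f x) (f y)) j x z.
  by move=> /lift[z /finj ->].
elim: j u => [|j IHj] u; first by move=> /eqP <-; exists x => /=.
move=> /stepsSP[w /IHj[z -> xz]] /orP[/eqP <-|zu].
  by exists z => //; apply: stepsW xz.
have [_ /inf[z' uE] _] := sub _ _ zu; exists z' => //.
by apply/stepsSP; exists z; rewrite // -uE zu orbT.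
Qed.

(** This turns an oracle answer about a renumbered induced subgraph into a statement about solutions
    in the original graph. *)
Lemma edge_triangle_s_club_induced (n m : nat) (f : 'I_m -> 'I_n)
    (e : rel 'I_m) (g : rel 'I_n) (s k : nat) :
  injective f -> (forall x y, e x y = g (f x) (f y)) -> irreflexive g ->
  edge_triangle_s_club s 1 e k <->
  exists S : {set 'I_n}, [/\ S \subset f @: setT, k <= #|S|
    & edge_triangle_property s 1 g S].
Proof.
move=> finj eg girr; split=> [[S [le_k etp]]|[S [Sf le_k etp]]].
  exists (f @: S); rewrite card_imset // imsetS ?subsetT //; split=> //.
  exact: edge_triangle_imset etp.
exists (f @^-1: S); split; last exact: edge_triangle_preimset etp.
rewrite -(card_imset _ finj); apply: leq_trans le_k (subset_leq_card _).
apply/subsetP => u uS; have /imsetP[x _ uE] := subsetP Sf u uS.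
by rewrite uE imset_f // inE -uE.
Qed.

(** * Total correctness with time bounds *)

(** The time [t] is an upper bound rather than the exact value, so that both branches of a
    conditional and all rounds of a loop can share it. *)
Definition runs (Q : graph_problem) (N : nat) (c : cmd) (m : state) (t : nat)
    (P : state -> Prop) : Prop :=
  exists t' m', [/\ exec Q N c m t' m', t' <= t & P m'].

Lemma runs_conseq Q N c m t t' (P P' : state -> Prop) :
  t <= t' -> (forall m', P m' -> P' m') ->
  runs Q N c m t P -> runs Q N c m t' P'.
Proof.
move=> le_t PP' [u [m' [cm le_u /PP' Pm']]].
by exists u, m'; split=> //; apply: leq_trans le_u le_t.
Qed.

Lemma runs_skip Q N m t (P : state -> Prop) : 0 < t -> P m -> runs Q N Skip m t P.
Proof. by move=> t_gt0 Pm; exists 1, m; split=> //; constructor. Qed.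

Lemma runs_store Q N a i v m (P : state -> Prop) :
  P (update m a (eval m i) (eval m v)) -> runs Q N (Store a i v) m 1 P.
Proof.
move=> Pm; exists 1, (update m a (eval m i) (eval m v)); split=> //.
exact: ExecStore.
Qed.

Lemma runs_seq Q N c1 c2 m t1 t2 (P : state -> Prop) :
  runs Q N c1 m t1 (fun m' => runs Q N c2 m' t2 P) ->
  runs Q N (Seq c1 c2) m (t1 + t2) P.
Proof.
move=> [u1 [m1 [cm1 le1 [u2 [m2 [cm2 le2 Pm2]]]]]].
by exists (u1 + u2), m2; split; [apply: ExecSeq cm1 cm2 | apply: leq_add |].
Qed.

Lemma runs_if Q N x c1 c2 m t (P : state -> Prop) :
  (eval m x != 0 -> runs Q N c1 m t P) -> (eval m x = 0 -> runs Q N c2 m t P) ->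
  runs Q N (If x c1 c2) m t.+1 P.
Proof.
move=> P1 P2; have [x0|x0] := eqVneq (eval m x) 0.
  have [u [m' [cm le_u Pm']]] := P2 x0.
  by exists u.+1, m'; split=> //; apply: ExecIfFalse.
have [u [m' [cm le_u Pm']]] := P1 x0.
by exists u.+1, m'; split=> //; apply: ExecIfTrue.
Qed.

(** Excluded middle supplies a Boolean reflecting [Q], so a query that poses an instance within the
    size bound never gets stuck. *)
Lemma runs_query (Q : graph_problem) N r xn xk a m (n := eval m xn)
    (k := eval m xk) (e := @decode n (m a)) (P : state -> Prop) :
  is_instance e k -> n <= N ->
  (forall b : bool, (b <-> Q n e k) -> P (update m r 0 b)) ->
  runs Q N (Query r xn xk a) m (n ^ 2).+1 P.
Proof.
move=> inst le_n Pm.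
have query b : reflect (Q n e k) b -> runs Q N (Query r xn xk a) m (n ^ 2).+1 P.
  move=> Qb; exists (n ^ 2).+1, (update m r 0 b); split=> //; first exact: ExecQuery.
  by apply: Pm; apply: (iff_sym (rwP Qb)).
by case: (classic (Q n e k)) => Qe; [apply: (query true) | apply: (query false)];
  constructor.
Qed.

Definition var (a : nat) : expr := Cell a (Const 0).

Definition For (i : nat) (b : expr) (body : cmd) : cmd :=
  Seq (Store i (Const 0) (Const 0))
      (While (Minus b (var i)) (Seq body (Store i (Const 0) (Plus (var i) (Const 1))))).

(** Each round pays two steps beyond the body, for the test and the increment; the final 2 covers
    the initialization and the last, failing test. *)
Definition for_time (n t : nat) : nat := n * (t + 2) + 2.

(** [I j] describes the memory at the start of round [j], counter included, so the body has to lead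
    to [I j.+1] after the increment. The bound [b] is re-evaluated in each round; hence the
    invariant must fix its value. *)
Lemma runs_for Q N i b body m n t (I : nat -> state -> Prop) (P : state -> Prop) :
  I 0 (update m i 0 0) ->
  (forall j m, j <= n -> I j m -> eval m b = n) ->
  (forall j m, j < n -> I j m -> m i 0 = j ->
     runs Q N body m t (fun m' => m' i 0 = j /\ I j.+1 (update m' i 0 j.+1))) ->
  (forall m, I n m -> P m) ->
  runs Q N (For i b body) m (for_time n t) P.
Proof.
move=> I0 Ib Ibody IP; rewrite /for_time addnC (_ : 2 = 1 + 1) // -addnA.
apply/runs_seq/runs_store => /=.
suff loop d : forall j m, j + d = n -> I j m -> m i 0 = j ->
    runs Q N (While (Minus b (var i))
      (Seq body (Store i (Const 0) (Plus (var i) (Const 1))))) m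
      (1 + d * (t + (1 + 1))) P.
  by apply: (loop n 0) => //; rewrite /update !eqxx.
elim: d => [|d IHd] j m0 jd Im mi.
  rewrite addn0 in jd; exists 1, m0; split=> //; last by apply: IP; rewrite -jd.
  by apply: ExecWhileFalse; rewrite /= (Ib j) // ?mi jd ?subnn.
have lt_jn : j < n by lia.
have [u1 [m1 [cm1 le1 [mi1 I1]]]] := Ibody j m0 lt_jn Im mi.
have [||u2 [m2 [cm2 le2 Pm2]]] := IHd j.+1 (update m1 i 0 j.+1) _ I1.
- by rewrite addSn -addnS.
- by rewrite /update !eqxx.
exists ((u1 + 1) + u2).+1, m2; split=> //; last by rewrite mulSn; lia.
apply: ExecWhileTrue cm2.
  by rewrite /= (Ib j) ?(ltnW lt_jn) // mi -lt0n subn_gt0.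
apply: ExecSeq cm1 _; rewrite -[j.+1]addn1 -mi1.
exact: (ExecStore _ _ i (Const 0) (Plus (var i) (Const 1))).
Qed.

(** * The program *)

(* [a...] are arrays and [v...] scalar variables; [aTri] is the reflexive closure
   of the triangle edges and [aPow j] is its j-th power. *)
Local Notation aN := 0 (only parsing).
Local Notation aK := 1 (only parsing).
Local Notation aAdj := 2 (only parsing).
Local Notation aRow := 3 (only parsing).
Local Notation aTri := 4 (only parsing).
Local Notation vX := 5 (only parsing).
Local Notation vY := 6 (only parsing).
Local Notation vZ := 7 (only parsing).
Local Notation vAns := 8 (only parsing).
Local Notation vLen := 9 (only parsing).
Local Notation aList := 10 (only parsing).
Local Notation aSub := 11 (only parsing).
Local Notation vPos := 12 (only parsing).
Local Notation vOracle := 13 (only parsing).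
Local Notation aPow j := (14 + j) (only parsing).

Definition entry (a : nat) (x y : expr) : expr := Cell a (Plus (Cell aRow x) y).

Definition same_off (F : seq nat) (m m' : state) : Prop :=
  forall b i, b \notin F -> m' b i = m b i.

Lemma same_off_update F m m' a i v :
  a \in F -> same_off F m m' -> same_off F m (update m' a i v).
Proof.
move=> aF mm' b j bF; rewrite /update; case: eqP => [ba|_] /=; last exact: mm'.
by rewrite ba aF in bF.
Qed.

Lemma same_off_trans F G m1 m2 m3 :
  {subset F <= G} -> same_off F m1 m2 -> same_off G m2 m3 -> same_off G m1 m3.
Proof.
move=> FG m12 m23 b i bG; rewrite m23 // m12 //.
by apply: contra bG; apply: FG.
Qed.

Lemma row_major_inj n x y x' y' :
  y < n -> y' < n -> x * n + y = x' * n + y' -> x = x' /\ y = y'.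
Proof.
move=> lt_y lt_y' E; have n0 : 0 < n by apply: leq_ltn_trans lt_y.
have := congr1 (divn^~ n) E; have := congr1 (modn^~ n) E.
by rewrite /= !modnMDl !divnMDl // !modn_small // !divn_small // !addn0.
Qed.

(* The machine cannot multiply, so the row offsets x * n are tabulated. *)
Definition rows : cmd :=
  For vX (var aN)
    (Store aRow (Plus (var vX) (Const 1)) (Plus (Cell aRow (var vX)) (var aN))).

Lemma runs_rows Q N n m :
  m aN 0 = n -> m aRow 0 = 0 ->
  runs Q N rows m (for_time n 1)
    (fun m' => same_off [:: aRow; vX] m m' /\ forall x, x <= n -> m' aRow x = x * n).
Proof.
move=> mN mR; pose I j m' := same_off [:: aRow; vX] m m' /\
  forall x, x <= j -> m' aRow x = x * n.
apply: (runs_for (I := I)) => //.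
- split; first exact: same_off_update.
  by move=> x; rewrite leqn0 => /eqP ->.
- by move=> j m' _ [mm' _]; rewrite /= mm'.
move=> j m' lt_j [mm' IR] mX; apply: runs_store => /=; split.
  by rewrite /update /= mX.
split; first by do 2!apply: same_off_update => //.
move=> x le_x; rewrite /update /= mX addn1; case: eqP => [->|/eqP neq].
  by rewrite IR // (mm' aN) // mN mulSnr.
by apply: IR; rewrite -ltnS ltn_neqAle neq.
Qed.

(** * Boolean matrices by a triple loop *)

Definition fill (C : nat) (cond : expr) : cmd :=
  For vX (var aN) (For vY (var aN) (For vZ (var aN)
    (If cond (Store C (Plus (Cell aRow (var vX)) (var vY)) (Const 1)) Skip))).

Definition cube_time n := for_time n (for_time n (for_time n 2)).

(** The triples already visited when the loop counters are [i], [j], [l]. *)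
Definition lex3 (x y z i j l : nat) : bool :=
  (x < i) || (x == i) && ((y < j) || (y == j) && (z < l)).

(** Ones are never erased and [C] starts at zero, so at the start of each round an entry is 1
    exactly if a visited triple satisfies [g]. The condition is evaluated while [C] changes, so its
    meaning is required whatever [C] contains. *)
Lemma runs_fill Q N n C cond (g : 'I_n -> 'I_n -> 'I_n -> bool) m
    (F := [:: vX; vY; vZ; C]) :
  m aN 0 = n -> (forall x : 'I_n, m aRow x = x * n) ->
  C \notin [:: aN; aRow; vX; vY; vZ] -> (forall i, m C i = 0) ->
  (forall m' (x y z : 'I_n), same_off F m m' ->
     m' vX 0 = x -> m' vY 0 = y -> m' vZ 0 = z -> (eval m' cond != 0) = g x y z) ->
  runs Q N (fill C cond) m (cube_time n)
    (fun m' => same_off F m m' /\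
       forall x y : 'I_n, m' C (x * n + y) = [exists z, g x y z]).
Proof.
move=> mN mR; rewrite !inE !negb_or => /and5P[C0 CR CX CY CZ] mC gP.
have [CF XF YF ZF] : [/\ C \in F, vX \in F, vY \in F & vZ \in F].
  by rewrite !inE eqxx !orbT.
have mmN m' : same_off F m m' -> m' aN 0 = n.
  by move=> mm'; rewrite mm' ?mN // !inE !negb_or (eq_sym aN C).
pose J i j l m' := same_off F m m' /\ forall x y : 'I_n,
  m' C (x * n + y) = [exists z : 'I_n, g x y z && lex3 x y z i j l].
have Jeq i j l i' j' l' m' :
    (forall x y z : 'I_n, lex3 x y z i j l = lex3 x y z i' j' l') ->
    J i j l m' -> J i' j' l' m'.
  move=> E [mm' Jm]; split=> // x y; rewrite Jm; congr (nat_of_bool _).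
  by apply: eq_existsb => z; rewrite E.
have Jupd a v i j l m' :
    a \in [:: vX; vY; vZ] -> J i j l m' -> J i j l (update m' a 0 v).
  move=> aV [mm' Jm]; split.
    apply: same_off_update mm'; move: aV; rewrite !inE.
    by case/or3P => /eqP->; rewrite eqxx ?orbT.
  move=> x y; rewrite -Jm /update; case: eqP => [Ca|//].
  by move: aV; rewrite !inE -Ca (negPf CX) (negPf CY) (negPf CZ).
(* Counters at the end of a loop describe the same visited triples as the next position: [(i, j, n)]
   agrees with [(i, j.+1, 0)], and likewise one level up. *)
have J0 i j m' : J i j n m' -> J i j.+1 0 m'.
  by apply: Jeq => x y z; rewrite /lex3; have := ltn_ord z; lia.
have J1 i m' : J i n 0 m' -> J i.+1 0 0 m'.
  by apply: Jeq => x y z; rewrite /lex3; have := ltn_ord y; lia.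
apply: (runs_for (I := fun i m' => J i 0 0 m')).
- apply: Jupd => //; split=> // x y; rewrite mC.
  by symmetry; apply/eqP; rewrite eqb0; apply/existsP => -[z]; rewrite /lex3; lia.
- by move=> j m' _ [mm' _]; apply: mmN.
- move=> i m1 lt_i Jm1 mX1.
  apply: (runs_for (I := fun j m' => J i j 0 m' /\ m' vX 0 = i)).
  + by split; [apply: Jupd | ].
  + by move=> j m' _ [[mm' _] _]; apply: mmN.
  + move=> j m2 lt_j [Jm2 mX2] mY2.
    apply: (runs_for (I := fun l m' => [/\ J i j l m', m' vX 0 = i & m' vY 0 = j])).
    * by split; [apply: Jupd | |].
    * by move=> l m' _ [[mm' _] _ _]; apply: mmN.
    * move=> l m3 lt_l [Jm3 mX3 mY3] mZ3; have [mm3 E3] := Jm3.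
      have g3 := gP m3 (Ordinal lt_i) (Ordinal lt_j) (Ordinal lt_l) mm3 mX3 mY3 mZ3.
      apply: runs_if => gm; last first.
        apply: runs_skip => //; split=> //; split=> //; apply: Jupd => //.
        split=> // x y; rewrite E3; congr (nat_of_bool _).
        apply: eq_existsb => z; case gz: (g x y z) => //=.
        apply/idP/idP; rewrite /lex3; first by lia.
        have [Ex|] := eqVneq (x : nat) i; last by lia.
        have [Ey|] := eqVneq (y : nat) j; last by lia.
        have [Ez|] := eqVneq (z : nat) l; last by lia.
        move: g3; rewrite gm; have [-> -> ->] : [/\ Ordinal lt_i = x,
          Ordinal lt_j = y & Ordinal lt_l = z] by split; apply: val_inj.
        by rewrite gz.
      apply: runs_store => /=; split.
        by rewrite /update (negPf (_ : vZ != C)) // eq_sym.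
      split; first last.
      - by rewrite /update /= (negPf (_ : vY != C)) // eq_sym.
      - by rewrite /update /= (negPf (_ : vX != C)) // eq_sym.
      apply: Jupd => //; split; first exact: same_off_update.
      move=> x y; rewrite /update eqxx /= mX3 mY3.
      rewrite (_ : m3 aRow i = i * n); last first.
        rewrite mm3 ?(mR (Ordinal lt_i)) //.
        by rewrite !inE !negb_or (eq_sym aRow C).
      (* The written entry [(i, j)] has the witness [l]; any other entry gains no triple in this
         round. *)
      case: eqP => [/row_major_inj[||Ex Ey] //|neq].
        have [xE yE] : x = Ordinal lt_i /\ y = Ordinal lt_j by split; apply: val_inj.
        symmetry; apply/eqP; rewrite eqb1; apply/existsP; exists (Ordinal lt_l).
        by rewrite xE yE -g3 gm /lex3 /=; lia.
      rewrite E3; congr (nat_of_bool _); apply: eq_existsb => z.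
      congr (_ && _); rewrite /lex3.
      have [Ex|] := eqVneq (x : nat) i; last by lia.
      have [Ey|] := eqVneq (y : nat) j; last by lia.
      by rewrite Ex Ey in neq.
    by move=> m' [Jm' mX' mY']; split=> //; split=> //; apply/Jupd/J0.
  by move=> m' [Jm' mX']; split=> //; apply/Jupd/J1.
move=> m' [mm' Jm]; split=> // x y; rewrite Jm; congr (nat_of_bool _).
by apply: eq_existsb => z; rewrite /lex3 ltn_ord andbT.
Qed.

(** * Listing a matrix row and extracting the subgraph induced on it *)

Definition list_row (p : nat) : cmd :=
  Seq (Store vLen (Const 0) (Const 0))
    (For vY (var aN)
      (If (entry p (var vX) (var vY))
         (Seq (Store aList (var vLen) (var vY))
              (Store vLen (Const 0) (Plus (var vLen) (Const 1))))
         Skip)).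

Definition listed (n : nat) (m : state) (s : seq 'I_n) : Prop :=
  m vLen 0 = size s /\ forall i, i < size s -> m aList i = nth 0 (map val s) i.

(** Vertices are tried in increasing order, so none is appended twice. Hence the length of the list
    is the size of the row, and the list renumbers the row injectively. *)
Lemma runs_list_row Q N n p (g : rel 'I_n) (m : state) (v : 'I_n)
    (F := [:: vY; vLen; aList]) :
  m aN 0 = n -> m aRow v = v * n -> m vX 0 = v ->
  p \notin F -> (forall y : 'I_n, m p (v * n + y) = g v y) ->
  runs Q N (list_row p) m (for_time n 3).+1
    (fun m' => same_off F m m' /\
       exists s : seq 'I_n, [/\ uniq s, s =i [pred y | g v y] & listed m' s]).
Proof.
move=> mN mR mX pF mp; rewrite -add1n; apply/runs_seq/runs_store => /=.
pose I j m' := same_off F m m' /\ exists s : seq 'I_n,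
  [/\ uniq s, s =i [pred y : 'I_n | (y < j) && g v y] & listed m' s].
apply: (runs_for (I := I)).
- split; first by do 2!apply: same_off_update => //.
  by exists [::]; split=> //; rewrite /listed.
- by move=> j m' _ [mm' _]; rewrite /= mm'.
- move=> j m' lt_j [mm' [s [us sE [mL ml]]]] mY.
  have cE : (eval m' (entry p (var vX) (var vY)) != 0) = g v (Ordinal lt_j).
    rewrite /= mY (mm' vX) // mX (mm' aRow) // mR mm' // (mp (Ordinal lt_j)).
    by case: (g _ _).
  have lt1 (y : 'I_n) : (y < j.+1) = (y == Ordinal lt_j) || (y < j).
    by rewrite ltnS leq_eqVlt -val_eqE.
  apply: runs_if => [gj|gj].
    have js : Ordinal lt_j \notin s by rewrite sE inE ltnn.
    apply: (runs_seq (t1 := 1) (t2 := 1)); do 2!apply: runs_store => /=.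
    split; first by rewrite /update /=.
    split; first by do 3!apply: same_off_update => //.
    exists (rcons s (Ordinal lt_j)); split.
    + by rewrite rcons_uniq js.
    + move=> y; rewrite mem_rcons inE sE !inE lt1.
      by case: eqP => [->|//]; rewrite -cE gj.
    rewrite /listed /update /= size_rcons mL addn1; split=> // i.
    rewrite ltnS leq_eqVlt map_rcons nth_rcons size_map mY.
    by case: eqP => [->|_ /= lt_i]; rewrite ?ltnn ?lt_i // ml.
  apply: runs_skip => //; split=> //; split; first exact: same_off_update.
  exists s; split=> // y; rewrite sE !inE lt1; case: eqP => [->|//].
  by rewrite -cE gj eqxx ltnn.
move=> m' [mm' [s [us sE Ls]]]; split=> //; exists s; split=> // y.
by rewrite sE !inE ltn_ord.
Qed.

(** The row length of the new matrix is the length of the list, while [aRow] tabulates multiples of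
    [n] only. Advancing [vPos] by one per entry yields the row-major index without
    multiplication. *)
Definition submatrix : cmd :=
  Seq (Store vPos (Const 0) (Const 0))
    (For vY (var vLen) (For vZ (var vLen)
      (Seq (Store aSub (var vPos)
              (entry aAdj (Cell aList (var vY)) (Cell aList (var vZ))))
           (Store vPos (Const 0) (Plus (var vPos) (Const 1)))))).

Lemma runs_submatrix Q N n (g : rel 'I_n) (m : state) (s : seq 'I_n)
    (F := [:: vY; vZ; vPos; aSub]) (l := size s) :
  (forall x : 'I_n, m aRow x = x * n) ->
  (forall x y : 'I_n, m aAdj (x * n + y) = g x y) -> listed m s ->
  runs Q N submatrix m (for_time l (for_time l 2)).+1
    (fun m' => same_off F m m' /\ forall i j : 'I_l,
       m' aSub (i * l + j) = g (tnth (in_tuple s) i) (tnth (in_tuple s) j)).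
Proof.
move=> mR mA [mL ml].
rewrite -add1n; apply/runs_seq/runs_store => /=.
have lE (i : 'I_l) : m aList i = tnth (in_tuple s) i.
  by rewrite ml // (tnth_nth (tnth (in_tuple s) i)) (nth_map (tnth (in_tuple s) i)).
pose J p m' := [/\ same_off F m m', m' vPos 0 = p & forall i j : 'I_l,
  i * l + j < p ->
  m' aSub (i * l + j) = g (tnth (in_tuple s) i) (tnth (in_tuple s) j)].
have Jupd a v p m' : a \in [:: vY; vZ] -> J p m' -> J p (update m' a 0 v).
  rewrite !inE => aYZ [mm' mP mS]; split.
  - apply: same_off_update mm'; rewrite !inE.
    by case/orP: aYZ => ->; rewrite ?orbT.
  - by case/orP: aYZ => /eqP ->.
  - by case/orP: aYZ => /eqP ->.
have mmL m' p : J p m' -> m' vLen 0 = l by case=> mm' _ _; rewrite mm'.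
apply: (runs_for (I := fun i m' => J (i * l) m')).
- by apply: Jupd => //; split=> //; apply: same_off_update.
- by move=> j m' _ /mmL.
- move=> i m1 lt_i Jm1 mY1.
  apply: (runs_for (I := fun j m' => J (i * l + j) m' /\ m' vY 0 = i)).
  + by rewrite addn0; split=> //; apply: Jupd.
  + by move=> j m' _ [/mmL].
  + move=> j m2 lt_j [[mm2 mP2 mS2] mY2] mZ2.
    apply: (runs_seq (t1 := 1) (t2 := 1)); do 2!apply: runs_store => /=.
    rewrite [update m2 _ _ _ vPos 0]/update /= mY2 mZ2 mP2 addn1.
    split=> //; split=> //; apply: Jupd => //.
    split; first by do 2!apply: same_off_update => //.
      by rewrite addnS.
    move=> a b; rewrite addnS ltnS leq_eqVlt /update /=.
    (* The stored index determines its row and column, so the new value belongs to [a = i], [b = j];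
       smaller indices keep their values. *)
    case: eqP => [/row_major_inj[]// Ea Eb _|_ /= lt_ab]; last exact: mS2.
    rewrite -Ea -Eb !(mm2 aList) // !lE (mm2 aRow) // mR (mm2 aAdj) //.
  by move=> m' [Jm' mY']; split=> //; rewrite mulSnr; apply: Jupd.
move=> m' [mm' _ mS]; split=> // i j; apply: mS.
by have := ltn_ord i; have := ltn_ord j; nia.
Qed.

(** * Phases of the program: triangle edges, powers, ball sizes, queries *)

Definition loaded (n : nat) (e : rel 'I_n) (k : nat) (m : state) : Prop :=
  [/\ m aN 0 = n, m aK 0 = k, forall x : 'I_n, m aRow x = x * n
    & forall x y : 'I_n, m aAdj (x * n + y) = e x y].

Lemma loaded_same_off F n (e : rel 'I_n) k m m' :
  all (fun a => a \notin F) [:: aN; aK; aRow; aAdj] ->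
  same_off F m m' -> loaded e k m -> loaded e k m'.
Proof.
move=> /and5P[FN FK FR FA _] mm' [mN mK mR mA]; split=> [||x|x y]; by rewrite mm'.
Qed.

(** With truncated subtraction, the sum of both differences is the absolute difference. *)
Definition equal (a b : expr) : expr :=
  Minus (Const 1) (Plus (Minus a b) (Minus b a)).

Lemma eval_equal m a b : eval m (equal a b) = (eval m a == eval m b).
Proof. by rewrite /=; case: eqP; lia. Qed.

(** Three 0/1 values sum to more than 2 exactly if all are 1, so subtracting 2 expresses a
    conjunction; the outer sum is a disjunction. The equality term supplies the pauses allowed in
    [steps]. *)
Definition triangle_closure : cmd :=
  fill aTri (Plus (equal (var vX) (var vY))
    (Minus (Plus (Plus (entry aAdj (var vX) (var vZ)) (entry aAdj (var vZ) (var vY)))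
                 (entry aAdj (var vX) (var vY))) (Const 2))).

Lemma runs_triangle_closure Q N n (e : rel 'I_n) k m :
  loaded e k m -> (forall i, m aTri i = 0) ->
  runs Q N triangle_closure m (cube_time n)
    (fun m' => same_off [:: vX; vY; vZ; aTri] m m' /\ forall x y : 'I_n,
       m' aTri (x * n + y) = (x == y) || triangle_edge e x y).
Proof.
move=> Lm mT; have [mN _ mR _] := Lm.
pose g x y z := (x == y) || [&& e x z, e z y & e x y].
apply: (runs_conseq (leqnn _) _ (runs_fill _ _ (g := g) mN mR _ mT _)) => //.
  move=> m' [mm' E]; split=> // x y; rewrite E; congr (nat_of_bool _).
  apply/existsP/orP => [[z /orP[]]|[xy|/existsP[z xyz]]]; first by left.
  - by right; apply/existsP; exists z.
  - by exists x; rewrite /g xy.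
  by exists z; rewrite /g xyz orbT.
move=> m' x y z mm' X Y Z.
have [_ _ mR' mA'] : loaded e k m' by apply: loaded_same_off mm' Lm.
rewrite /g; have /= -> := eval_equal m' (var vX) (var vY).
rewrite X Y Z !mR' !mA' val_eqE.
by case: (x == y); case: (e x z); case: (e z y); case: (e x y).
Qed.

(** The exponent is fixed together with [s], so the powers are unrolled into the program text. Each
    has its own array because [fill] needs a target that is zero. *)
Fixpoint powers (j : nat) : cmd :=
  if j is i.+1 then
    Seq (powers i)
      (fill (aPow i.+1) (Minus (Plus (entry (aPow i) (var vX) (var vZ))
                                    (entry aTri (var vZ) (var vY))) (Const 1)))
  else fill (aPow 0) (equal (var vX) (var vY)).

Lemma runs_powers Q N n (e r : rel 'I_n) k m j :
  loaded e k m ->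
  (forall x y : 'I_n, m aTri (x * n + y) = (x == y) || r x y) ->
  m vAns 0 = 0 -> (forall i a, m (aPow i) a = 0) ->
  runs Q N (powers j) m (j.+1 * cube_time n)
    (fun m' => [/\ loaded e k m',
       forall x y : 'I_n, m' aTri (x * n + y) = (x == y) || r x y,
       m' vAns 0 = 0, forall i a, j < i -> m' (aPow i) a = 0
     & forall i (x y : 'I_n), i <= j -> m' (aPow i) (x * n + y) = steps r i x y]).
Proof.
move=> Lm mT mAns mP; elim: j => [|j IHj] /=.
  have [mN _ mR _] := Lm; rewrite mul1n.
  pose g (x y _ : 'I_n) := x == y.
  apply: (runs_conseq (leqnn _) _ (runs_fill _ _ (g := g) mN mR _ (mP 0) _)) => //.
    move=> m' [mm' E]; split.
    - exact: loaded_same_off mm' Lm.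
    - by move=> x y; rewrite mm'.
    - by rewrite mm'.
    - by move=> [|i] // a _; rewrite mm'.
    move=> [|i] // x y _; rewrite E /=; congr (nat_of_bool _).
    by apply/existsP/idP => [[]|]; [ | exists x].
  by move=> m' x y z mm' X Y Z; rewrite eval_equal /= X Y val_eqE /g; case: (x == y).
rewrite mulSnr; apply: runs_seq; apply: runs_conseq (leqnn _) _ IHj.
move=> m1 [L1 T1 Ans1 Z1 P1]; have [mN _ mR _] := L1.
pose g x y z := steps r j x z && ((z == y) || r z y).
apply: (runs_conseq (leqnn _) _
  (runs_fill _ _ (g := g) mN mR _ (fun i => Z1 j.+1 i (leqnn _)) _)) => //.
  move=> m' [mm' E]; split.
  - exact: loaded_same_off mm' L1.
  - by move=> x y; rewrite mm'.
  - by rewrite mm'.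
  - move=> i a lt_i; rewrite mm' ?Z1 //; first by apply: ltnW.
    by rewrite !inE /= eqn_add2l; lia.
  move=> i x y; rewrite leq_eqVlt => /predU1P[->|lt_i]; first by rewrite E.
  by rewrite mm' ?P1 // !inE /= eqn_add2l; lia.
move=> m' x y z mm' X Y Z.
have [_ _ mR' _] : loaded e k m' by apply: loaded_same_off mm' L1.
rewrite /= X Y Z !mR' !mm' //; last by rewrite !inE /= eqn_add2l; lia.
by rewrite P1 // T1 /g; case: (steps _ _ _ _); case: (_ || _).
Qed.

Lemma listed_card n (g : pred 'I_n) (s : seq 'I_n) m :
  uniq s -> s =i g -> listed m s -> m vLen 0 = #|[set y | g y]|.
Proof.
move=> us sE [-> _]; rewrite -(card_uniqP us); apply: eq_card => y.
by rewrite inE sE.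
Qed.

(** The term [1 - (k - len)] is 1 if [k <= len] and 0 otherwise, so [vAns] counts the rows with at
    least [k] members. *)
Definition sizes (p : nat) : cmd :=
  For vX (var aN)
    (Seq (list_row p)
      (Store vAns (Const 0)
        (Plus (var vAns) (Minus (Const 1) (Minus (var aK) (var vLen)))))).

Definition sizes_time n := for_time n ((for_time n 3).+1 + 1).

Lemma runs_sizes Q N n (e g : rel 'I_n) k m j
    (F := [:: vX; vY; vLen; aList; vAns]) :
  loaded e k m -> m vAns 0 = 0 ->
  (forall x y : 'I_n, m (aPow j) (x * n + y) = g x y) ->
  runs Q N (sizes (aPow j)) m (sizes_time n)
    (fun m' => same_off F m m' /\
       (m' vAns 0 != 0) = [exists v, k <= #|[set y | g v y]|]).
Proof.
move=> Lm mAns mP.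
pose I i m' := same_off F m m' /\
  (m' vAns 0 != 0) = [exists v : 'I_n, (v < i) && (k <= #|[set y | g v y]|)].
apply: (runs_for (I := I)).
- split; first exact: same_off_update.
  by rewrite /update /= mAns; symmetry; apply/existsP => -[].
- by case: Lm => mN _ _ _ i m' _ [mm' _]; rewrite /= mm'.
- move=> i m1 lt_i [mm1 Ans1] X1; apply: runs_seq.
  have [mN mK mR _] : loaded e k m1 by apply: loaded_same_off mm1 Lm.
  apply: (runs_conseq (leqnn _) _
    (runs_list_row _ _ (v := Ordinal lt_i) (g := g) mN (mR _) X1 _ _)) => //; last first.
    by move=> y; rewrite mm1 // mP.
  move=> m2 [mm2 [s [us sE Ls]]]; apply: runs_store => /=.
  split; first by rewrite /update /= mm2.
  split.
    do 2!apply: same_off_update => //; apply: same_off_trans mm1 _ => //.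
    by move=> b a bF; apply: mm2; apply: contra bF; rewrite !inE; case/or3P => ->;
      rewrite ?orbT.
  rewrite /update /= (listed_card us sE Ls) (mm2 vAns) // (mm2 aK) // mK.
  have -> : [exists v : 'I_n, (v < i.+1) && (k <= #|[set y | g v y]|)] =
    (m1 vAns 0 != 0) || (k <= #|[set y | g (Ordinal lt_i) y]|).
    rewrite Ans1; apply/existsP/orP => [[v /andP[]]|[/existsP[v /andP[]]|le_k]].
    + rewrite ltnS leq_eqVlt => /predU1P[Ev|lt_v] le_k; last first.
        by left; apply/existsP; exists v; rewrite lt_v.
      by right; rewrite (_ : Ordinal lt_i = v) //; apply: val_inj.
    + by move=> lt_v le_k; exists v; rewrite ltnW.
    by exists (Ordinal lt_i); rewrite leqnn.
  move: (m1 vAns 0) #|_| => a b; lia.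
move=> m' [mm' Ans']; split=> //; rewrite Ans'; apply: eq_existsb => v.
by rewrite ltn_ord.
Qed.

Definition queries (p : nat) : cmd :=
  For vX (var aN)
    (Seq (list_row p)
      (Seq submatrix
        (Seq (Query vOracle (var vLen) (var aK) aSub)
          (Store vAns (Const 0) (Plus (var vAns) (var vOracle)))))).

Definition queries_time n :=
  for_time n ((for_time n 3).+1 +
    ((for_time n (for_time n 2)).+1 + ((n ^ 2).+1 + 1))).

Lemma for_time_leq n n' t t' :
  n <= n' -> t <= t' -> for_time n t <= for_time n' t'.
Proof. by move=> le_n le_t; rewrite leq_add2r leq_mul // leq_add2r. Qed.

Definition club_within (n : nat) (s : nat) (e : rel 'I_n) (k : nat)
    (B : {set 'I_n}) : Prop :=
  exists S : {set 'I_n},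
    [/\ S \subset B, k <= #|S| & edge_triangle_property s 1 e S].

(** The bound on the rows of [g] makes every query legal. [vAns] sums the answers, so it is nonzero
    exactly if some row contains a solution. *)
Lemma runs_queries N n s (e g : rel 'I_n) k m j :
  is_instance e k -> loaded e k m -> m vAns 0 = 0 ->
  (forall x y : 'I_n, m (aPow j) (x * n + y) = g x y) ->
  (forall v, #|[set y | g v y]| <= N) ->
  runs (edge_triangle_s_club s 1) N (queries (aPow j)) m (queries_time n)
    (fun m' => m' vAns 0 != 0 <-> exists v, club_within s e k [set y | g v y]).
Proof.
move=> [[esym eirr] k_gt0] Lm mAns mP leN.
pose F := [:: vX; vY; vZ; vLen; aList; vPos; aSub; vOracle; vAns].
pose I i m' := same_off F m m' /\ (m' vAns 0 != 0 <->
  exists v : 'I_n, v < i /\ club_within s e k [set y | g v y]).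
apply: (runs_for (I := I)).
- split; first exact: same_off_update.
  by rewrite /update /= mAns; split=> // -[v []].
- by case: Lm => mN _ _ _ i m' _ [mm' _]; rewrite /= mm'.
- move=> i m1 lt_i [mm1 Ans1] X1; apply: runs_seq.
  have L1 : loaded e k m1 by apply: loaded_same_off mm1 Lm.
  have [mN mK mR _] := L1.
  apply: (runs_conseq (leqnn _) _
    (runs_list_row _ _ (v := Ordinal lt_i) (g := g) mN (mR _) X1 _ _)) => //; last first.
    by move=> y; rewrite mm1 // mP.
  move=> m2 [mm2 [l [ul lE Ll]]]; apply: runs_seq.
  have L2 : loaded e k m2 by apply: loaded_same_off mm2 L1.
  have [_ _ mR2 mA2] := L2; have [Len2 _] := Ll.
  have le_l : size l <= n by rewrite -{2}(card_ord n) -(card_uniqP ul) max_card.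
  apply: (runs_conseq _ _ (runs_submatrix _ _ mR2 mA2 Ll)).
    by rewrite ltnS; do !apply: for_time_leq.
  move=> m3 [mm3 Sub3]; have [_ K3 _ _] : loaded e k m3 by apply: loaded_same_off mm3 L2.
  have Len3 : eval m3 (var vLen) = size l by rewrite /= mm3.
  apply: runs_seq.
  apply: (@runs_conseq _ _ _ _ ((eval m3 (var vLen)) ^ 2).+1 _ _ _ _ (fun _ Pm => Pm)).
    by rewrite Len3 ltnS leq_exp2r.
  have f_inj : injective (tnth (in_tuple l)) by apply/tuple_uniqP.
  have fT : tnth (in_tuple l) @: setT = [set y | g (Ordinal lt_i) y].
    apply/setP => y; rewrite inE; have := lE y; rewrite inE => <-.
    apply/imsetP/idP => [[a _ ->]|yl]; first exact: mem_tnth.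
    by have /tnthP[a ->] : y \in in_tuple l by []; exists a.
  (* The oracle's vertex type has the evaluated [vLen] as its bound, equal to [size l] only through
     [Len3]; [cast_ord] bridges the two. *)
  have dec : forall x y : 'I_(eval m3 (var vLen)),
     @decode (eval m3 (var vLen)) (m3 aSub) x y =
     e (tnth (in_tuple l) (cast_ord Len3 x)) (tnth (in_tuple l) (cast_ord Len3 y)).
    move=> x y; rewrite /decode.
    have -> : x * eval m3 (var vLen) + y = cast_ord Len3 x * size l + cast_ord Len3 y.
      by congr (_ * _ + _).
    by rewrite Sub3; case: (e _ _).
  have f3_inj : injective (fun x => tnth (in_tuple l) (cast_ord Len3 x)).
    by move=> x y /f_inj/cast_ord_inj.
  apply: runs_query.
  + split; last by rewrite /= K3.
    by split=> [x y|x]; rewrite !dec.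
  + rewrite Len3 -Len2 (listed_card ul lE Ll); exact: leN.
  move=> b bQ; apply: runs_store => /=; split.
    by rewrite /update /= mm3 // mm2.
  split.
    do 3!apply: same_off_update => //; apply: same_off_trans mm1 _ => //.
    apply: (@same_off_trans [:: vY; vLen; aList] _ _ m2) => //.
      by move=> a; rewrite !inE => /or3P[]->; rewrite ?orbT.
    by move=> a c aF; apply: mm3; apply: contra aF; rewrite !inE;
      case/or4P => ->; rewrite ?orbT.
  rewrite /update /= (mm3 vAns) // (mm2 vAns) // addn_eq0 negb_and eqb0 negbK.
  have bP : b <-> club_within s e k [set y | g (Ordinal lt_i) y].
    rewrite bQ (edge_triangle_s_club_induced _ _ f3_inj dec eirr) /= K3.
    rewrite (_ : _ @: setT = [set y | g (Ordinal lt_i) y]) // -fT.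
    apply/setP => y; apply/imsetP/imsetP => -[x _ ->].
      by exists (cast_ord Len3 x).
    by exists (cast_ord (Logic.eq_sym Len3) x); rewrite ?cast_ordKV.
  split=> [/orP[/Ans1[v [lt_v cl]]|/bP cl]|[v [lt_v cl]]].
  + by exists v; rewrite ltnW.
  + by exists (Ordinal lt_i).
  apply/orP; move: lt_v; rewrite ltnS leq_eqVlt => /predU1P[Ev|lt_v].
    by right; apply/bP; rewrite (_ : Ordinal lt_i = v) //; apply: val_inj.
  by left; apply/Ans1; exists v.
move=> m' [_ Ans']; split=> [/Ans'[v []]|[v cl]]; first by exists v.
by apply/Ans'; exists v.
Qed.

(* A positive answer of [sizes] must suppress the queries: the balls of radius s
   are only known to be small enough for the oracle if those of radius h are. *)
Definition kernel (h s : nat) : cmd :=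
  Seq rows (Seq triangle_closure (Seq (powers s) (Seq (sizes (aPow h))
    (Seq (If (var vAns) Skip (queries (aPow s))) (Store aN (Const 0) (var vAns)))))).

Definition kernel_time (s n : nat) : nat :=
  for_time n 1 + (cube_time n + (s.+1 * cube_time n +
    (sizes_time n + ((queries_time n).+1 + 1)))).

Lemma encode_entry n (e : rel 'I_n) (x y : 'I_n) : encode e (x * n + y) = e x y.
Proof.
rewrite /encode; congr (nat_of_bool _).
apply/existsP/idP => [[x' /existsP[y' /andP[/eqP/row_major_inj[]// Ex Ey]]]|exy].
  by rewrite (_ : x = x') 1?(_ : y = y') //; apply: val_inj.
by exists x; apply/existsP; exists y; rewrite eqxx.
Qed.

Lemma runs_kernel s c n (e : rel 'I_n) k (h := s./2) :
  s <= c * h -> is_instance e k ->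
  runs (edge_triangle_s_club s 1) (k ^ c) (kernel h s) (input_state e k)
    (kernel_time s n)
    (fun m => accepting m <-> edge_triangle_s_club s 1 e k).
Proof.
move=> le_s inst; have [[esym eirr] k_gt0] := inst; set r := triangle_edge e.
have le_hs : h <= s by rewrite /h; lia.
apply: runs_seq; apply: (runs_conseq (leqnn _) _ (runs_rows _ _ (n := n) _ _)) => //.
move=> m1 [mm1 R1].
have L1 : loaded e k m1.
  split=> [||x|x y]; rewrite ?R1 ?mm1 //; first exact: ltnW.
  by rewrite /= encode_entry.
apply: runs_seq; apply: (runs_conseq (leqnn _) _ (runs_triangle_closure _ _ L1 _)).
  move=> m2 [mm2 T2]; have L2 : loaded e k m2 by apply: loaded_same_off mm2 L1.
  apply: runs_seq; apply: (runs_conseq (leqnn _) _ (runs_powers _ _ s L2 T2 _ _)).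
  - move=> m3 [L3 _ Ans3 _ P3]; apply: runs_seq.
    apply: (runs_conseq (leqnn _) _
      (runs_sizes _ _ L3 Ans3 (fun x y => P3 h x y le_hs))).
    move=> m4 [mm4 Ans4]; have L4 : loaded e k m4 by apply: loaded_same_off mm4 L3.
    apply: runs_seq; apply: runs_if => /= [|Ans0].
      rewrite Ans4 => /existsP[v le_k].
      apply: runs_skip; first by rewrite /queries_time /for_time addn2.
      apply: runs_store; rewrite /accepting /update /= Ans4; split=> _.
        exists [set y | steps r h v y]; split=> //.
        by apply: ball_edge_triangle => //; rewrite /h; lia.
      by apply/existsP; exists v.
    have small v : #|[set y | steps r h v y]| <= k.
      have : ~~ [exists v, k <= #|[set y | steps r h v y]|] by rewrite -Ans4 Ans0.
      by rewrite negb_exists => /forallP/(_ v); rewrite -ltnNge => /ltnW.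
    have P4 (x y : 'I_n) : m4 (aPow s) (x * n + y) = steps r s x y.
      by rewrite mm4 // P3.
    have leN v : #|[set y | steps r s v y]| <= k ^ c.
      apply: leq_trans (card_steps_mul c v small); apply: subset_leq_card.
      by apply/subsetP => y; rewrite !inE; apply: stepsW.
    apply: (runs_conseq (leqnn _) _ (runs_queries _ inst L4 Ans0 P4 leN)).
    move=> m5 Ans5; apply: runs_store; rewrite /accepting /update /= Ans5.
    split=> [[v [S [_ le_k etp]]]|[S [le_k etp]]]; first by exists S.
    (* Since [k] is positive, a solution has a vertex to serve as centre. *)
    have /card_gt0P[v vS] : 0 < #|S| by apply: leq_trans le_k.
    by exists v, S; split=> //; apply: edge_triangle_sub_ball etp vS.
  - by rewrite mm2 // mm1.
  - by move=> i a; rewrite mm2 // mm1.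
by move=> i; rewrite mm1.
Qed.

(** * Polynomial bound on the running time *)

Lemma for_time_exp n t a b :
  t <= a * n.+1 ^ b -> for_time n t <= (a + 4) * n.+1 ^ b.+1.
Proof.
move=> le_t; rewrite /for_time expnSr; have : 0 < n.+1 ^ b by rewrite expn_gt0.
nia.
Qed.

(** Every loop raises the degree by one and the coefficient by 4, so a triple loop has coefficient
    14. The [s.+1] powers give [14 * s + 14]; all other phases fit into the rest. *)
Lemma kernel_time_exp s n : kernel_time s n <= (14 * s + 100) * n.+1 ^ 4.
Proof.
have F1 t : t <= t * n.+1 ^ 0 by rewrite muln1.
have cube := for_time_exp (for_time_exp (for_time_exp (F1 2))).
have row := for_time_exp (F1 1).
have list := for_time_exp (F1 3); have sub := for_time_exp (for_time_exp (F1 2)).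
have exp1 i : n.+1 ^ i <= n.+1 ^ i.+1 by rewrite leq_pexp2l.
have siz : sizes_time n <= 13 * n.+1 ^ 2.
  apply: (@for_time_exp _ _ 9 1); have := exp1 0; lia.
have que : queries_time n <= 25 * n.+1 ^ 3.
  apply: (@for_time_exp _ _ 21 2); have := exp1 0; have := exp1 1.
  have : n ^ 2 <= n.+1 ^ 2 by rewrite leq_exp2r.
  lia.
have {}cube : cube_time n <= 14 * n.+1 ^ 4.
  by apply: leq_trans cube _; rewrite leq_mul2l exp1 orbT.
rewrite /kernel_time; have := exp1 0; have := exp1 1; have := exp1 2; have := exp1 3.
nia.
Qed.

(** One constant, depending only on [s], serves as factor and exponent: [n.+1] is at most the
    instance size, and 4 is at most [14 * s + 100]. *)
Lemma turing_kernel_half s c :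
  s <= c * s./2 -> turing_kernel (edge_triangle_s_club s 1) (fun k => k ^ c).
Proof.
move=> le_s; exists (kernel s./2 s), (14 * s + 100) => n e k inst.
have [t [m [km le_t Pm]]] := runs_kernel le_s inst; exists t, m; split=> //.
apply: leq_trans le_t (leq_trans (kernel_time_exp s n) _).
rewrite leq_mul2l; apply/orP; right.
have le_n : n.+1 <= instance_size n k.
  by rewrite /instance_size; nia.
apply: (@leq_trans (instance_size n k ^ 4)); first by rewrite leq_exp2r.
by apply: leq_pexp2l; [apply: leq_trans le_n | rewrite ltn_addl].
Qed.

Theorem theorem3 (s : nat) :
  (~~ odd s -> turing_kernel (edge_triangle_s_club s 1) (fun k => k ^ 2)) /\
  (odd s -> 3 <= s ->
     turing_kernel (edge_triangle_s_club s 1) (fun k => k ^ 3)).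
(* For [s] even, [s] equals [2 * s./2]; for [s] odd and at least 3, [s./2] is positive, so
   [s = 2 * s./2 + 1 <= 3 * s./2]. *)
Proof. by split=> *; apply: turing_kernel_half; lia. Qed.
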